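(* Let $n\ge3$ and $p\in\mathcal H(n,d)$. Then for every $j\in\{1,\dots,n\}$, at least $d$ of the monomials of $p$ with nonzero coefficient are divisible by $x_j$.
   Context: $s(x)=x_1+\dots+x_n$. $\mathcal H(n,d)$ is the set of $p\in\mathbb R[x_1,\dots,x_n]$ of degree $d$ with all coefficients nonnegative and $p(x)=1$ whenever $s(x)=1$. *)

(* Defs.v *)
From HB Require Import structures.
From mathcomp Require Import all_boot all_order all_algebra.
Set Implicit Arguments. Unset Strict Implicit. Unset Printing Implicit Defensive.
Import Order.TTheory GRing.Theory Num.Theory.
Local Open Scope ring_scope.

Definition expv (n d : nat) := {ffun 'I_n -> 'I_d.+1}.

Definition mdeg n d (a : expv n d) : nat := (\sum_(i < n) (a i : nat))%N.

Definition meval (R : ringType) n d (c : expv n d -> R) (x : 'I_n -> R) : R :=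
  \sum_(a : expv n d) c a * \prod_(i < n) x i ^+ (a i).

Definition svar (R : ringType) n (x : 'I_n -> R) : R := \sum_(i < n) x i.

Definition inH (R : realFieldType) n d (c : expv n d -> R) : Prop :=
  [/\ forall a, 0 <= c a,
      forall a, (d < mdeg a)%N -> c a = 0,
      exists a, mdeg a = d /\ c a != 0
    & forall x : 'I_n -> R, svar x = 1 -> meval c x = 1].

(* Main.v *)
Require Import Defs.
From HB Require Import structures.
From mathcomp Require Import all_boot all_order all_algebra.
From mathcomp Require Import zify ring lra.
Import Order.TTheory GRing.Theory Num.Theory.
Local Open Scope ring_scope.
Set Implicit Arguments. Unset Strict Implicit.

(** Let x = x_j and y = x_j' be two of the variables and put the remaining ones
    equal to 1, keeping track of the degree separately.  With m = n - 2,
    L = y + m and S = x + L, the degree k parts P_k of p and Q_k of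
    q = (1 - p) / (1 - s) satisfy Q_0 = 1 - P_0, Q_(k+1) = S Q_k - P_(k+1),
    Q_d = 0, and Q_k <> 0 for k < d.

    Write Q_k as a polynomial in x with coefficients h_i in R[y], and read off the
    sign of h_i in two ways: from its leading and from its lowest coefficient.
    In either view count the maximal blocks of constant sign in the sequence
    (-1)^i sg(h_i).  As in the proof of Descartes' rule, multiplication by S
    creates one more block: the new ones are certified at the block starts i (there
    h_(i-1) + L h_i has the sign of h_i) and at i = size h.  Subtracting P_(k+1) can
    destroy a certificate, which costs at most two blocks.  A single monomial x^i y^e cannot
    destroy the certificate at i in both views: this takes e >= size h_i in the
    first view and e < size h_i in the second (here n >= 3 enters).  So each
    monomial divisible by x costs at most 2 blocks, summed over both views.
    The coefficient h_0 is positive in both views until it vanishes for good, so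
    that the monomials free of x cost 2 in total, which the two initial blocks
    pay.  Hence 2 d is at most twice the number of monomials divisible by x. *)

(** * Counting alternating blocks of a sequence, and how the count changes *)

Section AlternatingBlocks.
Variable V : zmodType.
Implicit Types s t : nat -> V.

(* The signs (-1)^i are built in: [expected s n] is the value at [n] that would
   continue the current block, and [0] before the first nonzero entry. *)
Fixpoint expected s n : V :=
  if n is k.+1 then - (if s k == 0 then expected s k else s k) else 0.

Definition block_start s i := (s i != 0) && (s i != expected s i).

Definition blocks s n : nat := (\sum_(i < n) block_start s i)%N.

Definition killed s t i := block_start s i && (t i != s i).

(* Losing an interior block start merges its two neighbours, so it costs two
   blocks; the first one costs a single block. *)
Definition loss s t n : nat := (\sum_(i < n) (0 < i).+1 * killed s t i)%N.

(* The extra term is what makes the induction work: once [t] has started a block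
   of the sign opposite to that of [s], it is one block ahead. *)
Lemma blocks_loss s t n : (killed s t 0 -> t 0%N = 0) ->
  (blocks s n + ((expected t n != expected s n) && (expected t n != 0%R))
    <= blocks t n + loss s t n)%N.
Proof.
move=> t0; elim: n => [|n]; first by rewrite /blocks /loss !big_ord0 eqxx.
rewrite /blocks /loss !big_ord_recr /=.
move: (bigop _ _ _) (bigop _ _ _) (bigop _ _ _) => l bt bs.
rewrite oppr_eq0 eqr_opp /killed /block_start.
have caseE (a b : V) : {a = b} + {a != b} by case: eqVneq; [left | right].
have neqF (a b : V) : a != b -> ((a == b) = false) * ((b == a) = false).
  by move=> /negbTE ab; split; rewrite // eq_sym.
(* Position 0 is separate: a loss there weighs only 1, and the hypothesis on [t 0] makes this
   enough. Elsewhere the claim is a finite check on the two entries and the two expected values. *)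
case: (posnP n) => [n0|n_gt0].
  subst n; move: t0; rewrite /killed /block_start /=.
  move: (s 0%N) (t 0%N) => x y.
  case: (caseE x 0) => [->|/neqF x0].
    by rewrite eqxx /=; case: (y == 0); rewrite ?eqxx ?andbF /=; lia.
  case: (caseE y 0) => [->|/neqF y0]; first by rewrite !eqxx !x0 andbF /=; lia.
  case: (caseE y x) => [->|/neqF yx]; first by rewrite !eqxx !x0 /=; lia.
  by rewrite !x0 !y0 !yx /= => /(_ isT) E; rewrite E eqxx in y0; case: y0.
clear t0; move: (s n) (t n) (expected s n) (expected t n) => x y e e'.
case: (caseE x 0) => [->|/neqF x0].
  rewrite eqxx /=; case: (caseE y 0) => [->|/neqF y0]; first by rewrite eqxx /=; lia.
  rewrite !y0 /=; case: (caseE y e') => [<-|/neqF ye']; last first.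
    by rewrite !ye'; case: (y != e); case: (e' != e); case: (e' != 0); lia.
  by rewrite !y0; case: (y != e); rewrite eqxx; lia.
case: (caseE y x) => [->|/neqF yx].
  rewrite !x0 eqxx andbF /= ?andbT; case: (caseE x e') => [<-|/neqF xe'].
    by rewrite !x0 eqxx; case: (x == e); lia.
  by rewrite !xe'; case: (x == e); case: (e' == e); case: (e' == 0); lia.
case: (caseE x e) => [<-|/neqF xe].
  rewrite eqxx !andbF /= !x0; case: (caseE y 0) => [->|/neqF y0].
    by rewrite eqxx /=; case: (e' != x); case: (e' != 0); lia.
  rewrite !y0 !yx /=; case: (caseE y e') => [<-|/neqF ye']; first by rewrite !yx !y0 eqxx; lia.
  by rewrite !ye'; case: (e' != x); case: (e' != 0); lia.
rewrite !x0 !xe !yx /=.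
set A := (if _ then _ else _).
case: (caseE y 0) => [y0|/neqF y0].
  by rewrite /A y0 eqxx /=; case: (e' != e); case: (e' != x); case: (e' != 0); lia.
rewrite /A !y0 !yx /=.
case: (caseE y e') => [<-|/neqF ye']; first by rewrite eqxx !y0; case: (y != e); lia.
by rewrite !ye'; case: (e' != e); case: (e' != 0); lia.
Qed.

Lemma blocks_after s D n : (forall i, (D < i)%N -> s i = 0) -> (D < n)%N ->
  blocks s n = blocks s D.+1.
Proof.
move=> s0; elim: n => // n IH; rewrite ltnS leq_eqVlt => /orP[/eqP-> //|Dn].
by rewrite /blocks big_ord_recr -!/(blocks _ _) (IH Dn) /block_start s0 // eqxx /= addn0.
Qed.

Lemma leq_blocks s n n' : (n <= n')%N -> (blocks s n <= blocks s n')%N.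
Proof.
move=> /subnK<-; elim: (n' - n)%N => // k IH.
by rewrite addSn; apply: leq_trans IH _; rewrite /blocks big_ord_recr leq_addr.
Qed.

(** The gain comes from [D.+1], one past the last nonzero entry of [s]. If [t D.+1 = s D], then
    either [t] starts a block there, or [t] was expecting [s D] and not [- s D], and the extra term
    of [blocks_loss] supplies the missing block. *)
Lemma blocks_step s t D n :
    (killed s t 0 -> t 0%N = 0) -> s D != 0 -> - s D != s D ->
    (forall i, (D < i)%N -> s i = 0) -> (D.+1 < n)%N ->
  (blocks s n < blocks t n + loss s t D.+1 + (t D.+1 != s D))%N.
Proof.
move=> t0 sD0 sDN s0 Dn; rewrite (blocks_after s0 (ltnW Dn)).
have := leq_blocks t Dn; have := blocks_loss D.+1 t0.
rewrite [blocks t D.+2]/blocks big_ord_recr /= -/(blocks t _) (negbTE sD0).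
move: (blocks s _) (blocks t D.+1) (blocks t n) (loss _ _ _) => bs bt btn l.
rewrite /block_start /=; move: (if t D == 0 then _ else _) => e.
case: (eqVneq (t D.+1) 0) => [->|_] /=.
  rewrite [0 == s D]eq_sym sD0; case: (- e != - s D); case: (- e != 0) => /=; lia.
case: (eqVneq (t D.+1) (s D)) => [->|_] /=; last first.
  by case: (- e != - s D); case: (- e != 0); case: (_ != - e) => /=; lia.
case: (eqVneq (s D) (- e)) => [<-|_] /=; first by rewrite [s D == - _]eq_sym sDN sD0; lia.
by case: (- e != - s D); case: (- e != 0) => /=; lia.
Qed.

End AlternatingBlocks.

(** * The two sign views of a polynomial, and the effect of one recursion step on them *)

Section Views.
Variable R : realFieldType.
Implicit Types p q g : {poly R}.

(** On the zero polynomial the search runs past the end and the default gives 0, as for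
    [lead_coef]. *)
Definition low_coef p := p`_(find (predC1 0) p).

Lemma low_coefE p e : p`_e != 0 -> (forall i, (i < e)%N -> p`_i = 0) ->
  low_coef p = p`_e.
Proof.
move=> pe pi; rewrite /low_coef.
have e_lt : (e < size p)%N by rewrite ltnNge; apply: contra pe => /(nth_default 0)->.
have hp : has (predC1 0) p by apply/(has_nthP 0); exists e.
case: (ltngtP (find (predC1 0) p) e) => [lt|lt|-> //].
  by have := nth_find 0 hp; rewrite /= pi ?eqxx.
by have := before_find 0 lt; rewrite /= (negbTE pe).
Qed.

Lemma low_coef_ex p : p != 0 ->
  exists e, [/\ (e < size p)%N, p`_e != 0, low_coef p = p`_e
    & forall i, (i < e)%N -> p`_i = 0].
Proof.
move=> p0; have hp : has (predC1 0) p.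
  apply/(has_nthP 0); exists (size p).-1; first by rewrite prednK // size_poly_gt0.
  by rewrite /= -lead_coefE lead_coef_eq0.
exists (find (predC1 0) p); split => //; first by rewrite -has_find.
  exact: (nth_find 0 hp).
by move=> i /(before_find 0) /negbFE /eqP.
Qed.

Lemma low_coef_eq0 p : (low_coef p == 0) = (p == 0).
Proof.
apply/eqP/eqP => [|->]; last by rewrite /low_coef polyseq0 nth_nil.
case: (eqVneq p 0) => [//|/low_coef_ex [e [_ pe -> _]]] pe0.
by rewrite pe0 eqxx in pe.
Qed.

Definition lead_sg p := Num.sg (lead_coef p).
Definition low_sg p := Num.sg (low_coef p).

Lemma sg_add_same (x y : R) : x != 0 -> Num.sg x = Num.sg y -> Num.sg (x + y) = Num.sg y.
Proof.
move=> x0 E; case: (ltgtP y 0) => y0.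
- by move: E; rewrite (ltr0_sg y0) => /eqP; rewrite sgr_cp0 => x_lt; rewrite ltr0_sg //; lra.
- by move: E; rewrite (gtr0_sg y0) => /eqP; rewrite sgr_cp0 => x_lt; rewrite gtr0_sg //; lra.
- by move: E x0; rewrite y0 sgr0 => /eqP; rewrite sgr_eq0 => ->.
Qed.

Lemma sg_addN (x y : R) : x != 0 -> Num.sg x = Num.sg y -> x + y != 0.
Proof.
move=> x0 E; rewrite -sgr_eq0 sg_add_same //.
by rewrite -E sgr_eq0.
Qed.

Lemma lead_sgD p q : p != 0 -> lead_sg p = lead_sg q -> lead_sg (p + q) = lead_sg q.
Proof.
move=> p0; rewrite /lead_sg => E; case: (ltngtP (size p) (size q)) => sz.
- by rewrite lead_coefDr.
- by rewrite lead_coefDl.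
have lp : lead_coef p != 0 by rewrite lead_coef_eq0.
have top : (p + q)`_(size q).-1 = lead_coef p + lead_coef q.
  by rewrite coefD !lead_coefE sz.
have nz := sg_addN lp E.
have -> : lead_coef (p + q) = lead_coef p + lead_coef q.
  have szD : size (p + q) = size q.
    apply/eqP; rewrite eqn_leq (leq_trans (size_polyD _ _)) ?sz ?maxnn //=.
    rewrite leqNgt; apply/negP => lt; move: nz; rewrite -top nth_default ?eqxx //.
    by rewrite -ltnS prednK // (leq_ltn_trans _ lt).
  by rewrite lead_coefE szD.
exact: sg_add_same.
Qed.

Lemma low_sgD p q : p != 0 -> low_sg p = low_sg q -> low_sg (p + q) = low_sg q.
Proof.
move=> p0; rewrite /low_sg => E.
have q0 : q != 0 by rewrite -low_coef_eq0 -sgr_eq0 -E sgr_eq0 low_coef_eq0.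
have [a [_ pa Ea pi]] := low_coef_ex p0; have [b [_ qb Eb qi]] := low_coef_ex q0.
rewrite Ea Eb in E *; case: (ltngtP a b) => ab.
- rewrite (low_coefE (e := a)) ?coefD ?(qi a) ?addr0 // => i ia.
  by rewrite coefD pi // qi ?addr0 // (ltn_trans ia).
- rewrite (low_coefE (e := b)) ?coefD ?(pi b) ?add0r // => i ia.
  by rewrite coefD qi // pi ?addr0 // (ltn_trans ia).
- subst b; have nz := sg_addN pa E.
  rewrite (low_coefE (e := a)) ?coefD ?sg_add_same // => i ia.
  by rewrite coefD pi // qi // addr0.
Qed.

Lemma coef_in_or_out (P : pred nat) p :
  (exists2 e, P e & p`_e != 0) \/ (forall e, P e -> p`_e = 0).
Proof.
case: (boolP [exists e : 'I_(size p), P e && (p`_e != 0)]) => [/existsP[e /andP[? ?]]|].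
  by left; exists e.
rewrite negb_exists => /forallP none; right => e Pe.
case: (ltnP e (size p)) => [lt|]; last exact: nth_default.
by have := none (Ordinal lt); rewrite /= Pe /= negbK => /eqP.
Qed.

Variable m : R.
Hypothesis m_gt0 : 0 < m.
Local Notation L := ('X + m%:P : {poly R}).

Lemma size_XaddmC_mul p : p != 0 -> size (L * p) = (size p).+1.
Proof. by move=> p0; rewrite size_monicM ?size_XaddC ?monicXaddC. Qed.

(** [L * p] has one more coefficient than [p], so [g] stays below its leading term. The condition
    here and that of [low_sg_mulB] concern complementary exponents, so a single monomial of [g]
    cannot violate both. *)
Lemma lead_sg_mulB p g : p != 0 -> (forall e, (size p <= e)%N -> g`_e = 0) ->
  lead_sg (L * p - g) = lead_sg p.
Proof.
move=> p0 g0; rewrite /lead_sg lead_coefDl; first by rewrite lead_coefM lead_coefXaddC mul1r.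
rewrite size_polyN size_XaddmC_mul // ltnS; exact/leq_sizeP.
Qed.

(** Up to the lowest exponent of [p], the coefficients of [L * p - g] are those of [p] times [m];
    this is where [0 < m] matters. *)
Lemma low_sg_mulB p g : p != 0 -> (forall e, (e < size p)%N -> g`_e = 0) ->
  low_sg (L * p - g) = low_sg p.
Proof.
move=> /low_coef_ex [e [e_lt pe E pi]] g0.
have coefL i : (i <= e)%N -> (L * p - g)`_i = m * p`_i.
  move=> ie; rewrite coefB (g0 i) ?subr0; last exact: leq_ltn_trans e_lt.
  rewrite mulrDl coefD coefXM coefCM; case: i ie => [|i] ie /=; first by rewrite add0r.
  by rewrite pi ?add0r.
rewrite /low_sg (low_coefE (e := e)) ?coefL //.
- by rewrite sgrM gtr0_sg // mul1r E.
- by rewrite mulf_neq0 // gt_eqF.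
- by move=> i ie; rewrite coefL ?(ltnW ie) // pi // mulr0.
Qed.

Variables h g : {poly {poly R}}.
Hypothesis h0 : h != 0.
Local Notation h' := (('X + L%:P) * h - g).

Lemma coef_step0 : h'`_0 = L * h`_0 - g`_0.
Proof. by rewrite coefB mulrDl coefD coefXM coefCM add0r. Qed.

Lemma coef_stepS i : h'`_i.+1 = h`_i + (L * h`_i.+1 - g`_i.+1).
Proof. by rewrite coefB mulrDl coefD coefXM coefCM addrA. Qed.

Section OneView.
Variable c : {poly R} -> R.
Hypothesis c_eq0 : forall p, (c p == 0) = (p == 0).
Hypothesis c_add : forall p q, p != 0 -> Num.sg (c p) = Num.sg (c q) ->
  Num.sg (c (p + q)) = Num.sg (c q).

Definition view (f : {poly {poly R}}) i := Num.sg (c f`_i).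

(** At a block start, [h_i] is zero or has the sign of [h_(i+1)], so adding it cannot change the
    sign. Only the subtraction of [g] can. *)
Lemma killed_view i : killed (view h) (view h') i.+1 ->
  h`_i.+1 != 0 /\ Num.sg (c (L * h`_i.+1 - g`_i.+1)) != Num.sg (c h`_i.+1).
Proof.
rewrite /killed /block_start /= => /andP[/andP[nz start] kill].
rewrite /view in nz start; rewrite sgr_eq0 c_eq0 in nz; split => //.
apply: contra kill => /eqP E; rewrite /view coef_stepS.
case: (eqVneq h`_i 0) => [->|hi]; first by rewrite add0r E.
rewrite c_add // ?E //; move: start; rewrite sgr_eq0 c_eq0 (negbTE hi).
have : c h`_i.+1 != 0 by rewrite c_eq0.
have : c h`_i != 0 by rewrite c_eq0.
move: (c h`_i) (c h`_i.+1) => x y x0 y0.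
by case: (sgrP x) x0; case: (sgrP y) y0; rewrite ?opprK ?eqxx.
Qed.

(** This is [blocks_step] with [D = size h - 1]. At [size h] the step yields the top coefficient of
    [h] minus that of [g], which gives the new block whenever [g] vanishes there. *)
Lemma view_step n :
    (h`_0 != 0 -> h'`_0 != 0 -> view h' 0 = view h 0) -> (size h < n)%N ->
  (blocks (view h) n < blocks (view h') n + loss (view h) (view h') (size h)
                       + (g`_(size h) != 0)%R)%N.
Proof.
move=> bot hn.
have hD : (size h).-1.+1 = size h by rewrite prednK // size_poly_gt0.
have lead0 : h`_(size h).-1 != 0 by rewrite -lead_coefE lead_coef_eq0.
have s0 : view h (size h).-1 != 0 by rewrite /view sgr_eq0 c_eq0.
have /(_ n) := @blocks_step _ (view h) (view h') (size h).-1 _ _ s0 _ _ _.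
rewrite hD => H; apply: leq_trans (H _ _ _ hn) _.
- rewrite /killed /block_start /= => /andP[/andP[nz _]].
  apply: contraNeq => nz'; rewrite /view !sgr_eq0 !c_eq0 in nz nz'.
  by apply/eqP; apply: bot.
- by apply: contra s0 => /eqP E; apply/eqP; lra.
- move=> i hi; rewrite /view nth_default //.
  by apply/eqP; rewrite sgr_eq0 c_eq0.
rewrite leq_add2l; case: (eqVneq g`_(size h) 0) => [g0|_] /=; last exact: leq_b1.
rewrite /view -[X in h'`_X]hD coef_stepS hD g0 subr0 [h`_(size h)]nth_default //.
by rewrite mulr0 addr0 eqxx.
Qed.
End OneView.

Definition view_blocks n f := (blocks (view (@lead_coef R) f) n + blocks (view low_coef f) n)%N.

(** Each view gains one block, whence the 2 on the left. All that is asked of [mult] is to be a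
    lower-bounded count: at least 1 for a nonzero coefficient of [g], at least 2 for two distinct
    exponents of y in it. *)
Lemma view_blocks_step (mult : nat -> nat) n :
    (forall i, g`_i != 0 -> (0 < mult i)%N) ->
    (forall i e e', e != e' -> g`_i`_e != 0 -> g`_i`_e' != 0 -> (1 < mult i)%N) ->
    (h`_0 != 0 -> h'`_0 != 0 ->
       lead_sg h'`_0 = lead_sg h`_0 /\ low_sg h'`_0 = low_sg h`_0) ->
    (size h < n)%N ->
  (view_blocks n h + 2 <= view_blocks n h' + 2 * \sum_(1 <= i < n) mult i
                          + 2 * ((h`_0 != 0) && (h'`_0 == 0))%R)%N.
Proof.
move=> mult1 mult2 bot hn.
set l := view (@lead_coef R); set o := view low_coef.
have lstep := @view_step (@lead_coef R) (@lead_coef_eq0 R) n _ hn.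
have ostep := @view_step low_coef low_coef_eq0 n _ hn.
have {}lstep := lstep (fun a b => (bot a b).1).
have {}ostep := ostep (fun a b => (bot a b).2).
have topm : ((g`_(size h) != 0)%R <= mult (size h))%N.
  by case: eqVneq => // /mult1.
have kill0 (c : {poly R} -> R) : (forall p, (c p == 0) = (p == 0)) ->
    (h`_0 != 0 -> h'`_0 != 0 -> view c h' 0 = view c h 0) ->
    (killed (view c h) (view c h') 0 <= ((h`_0 != 0) && (h'`_0 == 0))%R)%N.
  move=> c0 ch; rewrite /killed /block_start /=; case: (eqVneq h`_0 0) => [E|nz] /=.
    by rewrite /view E (eqP (_ : Num.sg (c 0) == 0)) ?eqxx // sgr_eq0 c0.
  by case: (eqVneq h'`_0 0) => [//|nz']; [case: (_ && _) | rewrite ch // eqxx andbF].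
(* Kills in both views need one exponent at least [size h_i] and one below it, hence two monomials
   of [g]. *)
have killS i : (0 < i)%N ->
    (killed (l h) (l h') i + killed (o h) (o h') i <= mult i)%N.
  case: i => // i _.
  have kl : killed (l h) (l h') i.+1 -> exists2 e, (size (h`_i.+1)%R <= e)%N & g`_i.+1`_e != 0.
    move=> /(killed_view (@lead_coef_eq0 R) (@lead_sgD)) [nz ne].
    case: (coef_in_or_out (fun e => size (h`_i.+1)%R <= e)%N g`_i.+1) => // g0.
    by rewrite [X in X != _](lead_sg_mulB nz g0) eqxx in ne.
  have ko : killed (o h) (o h') i.+1 -> exists2 e, (e < size (h`_i.+1)%R)%N & g`_i.+1`_e != 0.
    move=> /(killed_view low_coef_eq0 low_sgD) [nz ne].
    case: (coef_in_or_out (fun e => e < size (h`_i.+1)%R)%N g`_i.+1) => // g0.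
    by rewrite [X in X != _](low_sg_mulB nz g0) eqxx in ne.
  have gnz e : g`_i.+1`_e != 0 -> g`_i.+1 != 0 by apply: contraNneq => ->; rewrite coef0.
  case: (killed (l h) _ _) kl => [/(_ isT) [e e_ge ge]|_];
    case: (killed (o h) _ _) ko => [/(_ isT) [e' e'_lt ge']|_] //=.
  - by apply: (mult2 i.+1 e e') => //; rewrite neq_ltn (leq_trans e'_lt e_ge) orbT.
  - exact: mult1 (gnz _ ge).
  - exact: mult1 (gnz _ ge').
have lossE c : loss (view c h) (view c h') (size h) =
    (killed (view c h) (view c h') 0
     + \sum_(1 <= i < size h) 2 * killed (view c h) (view c h') i)%N.
  rewrite /loss -(big_mkord xpredT (fun i => (0 < i).+1 * killed (view c h) (view c h') i)%N).
  rewrite big_ltn ?size_poly_gt0 //= mul1n; congr addn.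
  by apply: eq_big_nat => -[].
have sumk : (\sum_(1 <= i < size h) 2 * killed (l h) (l h') i
    + \sum_(1 <= i < size h) 2 * killed (o h) (o h') i
    <= 2 * \sum_(1 <= i < size h) mult i)%N.
  rewrite -big_split big_distrr /=; rewrite !big_nat; apply: leq_sum => i /andP[i0 _].
  by rewrite -mulnDr leq_mul2l killS ?orbT.
(* The kills use only indices below [size h], so [mult (size h)] is free to pay for the top
   certificate in both views. *)
have summ : (\sum_(1 <= i < size h) mult i + mult (size h) <= \sum_(1 <= i < n) mult i)%N.
  rewrite (big_cat_nat (n := size h) (p := n)) ?size_poly_gt0 ?(ltnW hn) //=.
  by rewrite leq_add2l big_ltn // leq_addr.
have kl0 := kill0 _ (@lead_coef_eq0 R) (fun a b => (bot a b).1).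
have ko0 := kill0 _ low_coef_eq0 (fun a b => (bot a b).2).
rewrite /view_blocks; rewrite !lossE -/l -/o in lstep ostep.
rewrite -/l -/o in kl0 ko0 *; lia.
Qed.
End Views.

(** * Signs of polynomials in y with nonnegative coefficients *)

Section Positivity.
Variables (R : realFieldType) (m : R).
Hypothesis m_gt0 : 0 < m.
Local Notation L := ('X + m%:P : {poly R}).
Implicit Types p : {poly R}.

Lemma sg_expM p k : p != 0 ->
  lead_sg (L ^+ k * p) = lead_sg p /\ low_sg (L ^+ k * p) = low_sg p.
Proof.
have L0 : L != 0 by rewrite monic_neq0 ?monicXaddC.
move=> p0; elim: k => [|k [IHl IHo]]; first by rewrite expr0 mul1r.
have q0 : L ^+ k * p != 0 by rewrite mulf_neq0 ?expf_neq0.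
rewrite exprS -mulrA -[L * (L ^+ k * p)]subr0.
by rewrite lead_sg_mulB ?low_sg_mulB // => e _; rewrite coef0.
Qed.

Lemma sg_nneg p : (forall i, 0 <= p`_i) -> p != 0 ->
  lead_sg p = 1 /\ low_sg p = 1.
Proof.
move=> pn p0; split; apply: gtr0_sg; rewrite lt_def.
  by rewrite lead_coef_eq0 p0; apply: pn.
by rewrite low_coef_eq0 p0; apply: pn.
Qed.
End Positivity.

(** * Bivariate polynomials with nonnegative coefficients *)

Section NonnegativeCoefficients.
Variable R : realFieldType.
Implicit Types p q : {poly {poly R}}.

Definition nneg2 p := forall i e, 0 <= p`_i`_e.

Lemma nneg2D p q : nneg2 p -> nneg2 q -> nneg2 (p + q).
Proof. by move=> pn qn i e; rewrite !coefD addr_ge0. Qed.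

Lemma nneg2M p q : nneg2 p -> nneg2 q -> nneg2 (p * q).
Proof.
move=> pn qn i e; rewrite coefM coef_sum sumr_ge0 // => k _.
by rewrite coefM sumr_ge0 // => l _; rewrite mulr_ge0.
Qed.

Lemma nneg2X p k : nneg2 p -> nneg2 (p ^+ k).
Proof.
move=> pn; elim: k => [i e|k IH]; last by rewrite exprS; apply: nneg2M.
by rewrite expr0 coef1; case: (i == 0)%N; rewrite ?coef1 ?coef0 ?ler0n.
Qed.

Lemma nneg2_addr_eq0 p q : nneg2 p -> nneg2 q -> p + q = 0 -> q = 0.
Proof.
move=> pn qn pq; apply/polyP => i; apply/polyP => e.
have : (p + q)`_i`_e = 0 by rewrite pq !coef0.
by rewrite !coefD !coef0; have := pn i e; have := qn i e; lra.
Qed.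
End NonnegativeCoefficients.

Lemma poly_nat_roots (D : idomainType) (f : nat -> D) (p : {poly D}) :
  injective f -> (forall k, p.[f k] = 0) -> p = 0.
Proof.
move=> f_inj pf; apply/eqP/negPn/negP => p0.
have := @max_poly_roots _ p [seq f k | k <- iota 0 (size p)] p0.
rewrite size_map size_iota ltnn => H; apply: notF; apply: H.
  by apply/allP => _ /mapP[k _ ->]; apply/eqP.
by rewrite map_inj_uniq ?iota_uniq.
Qed.

Lemma sum_eq_leq (b : bool) y n :
  (\sum_(1 <= i < n) (b && (y == i)) <= b && (0 < y))%N.
Proof.
case: b => /=; last by rewrite big1.
suff -> : (\sum_(1 <= i < n) (y == i) = (0 < y < n))%N by case: (0 < y)%N; case: (y < n)%N.
elim: n => [|[|n] IH]; first by rewrite big_geq // ltn0 andbF.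
  by rewrite big_geq // ltnS leqn0 lt0n andNb.
by rewrite big_nat_recr //= IH; case: (ltngtP y n.+1) => H; lia.
Qed.

(** * The homogeneous parts of p and the quotient by 1 - s *)

Section Hyperplane.
Variables (R : realFieldType) (n d : nat) (c : expv n d -> R) (j j' : 'I_n).
Hypothesis cH : inH c.
Hypothesis jj' : j' != j.

Definition others : R := \sum_(i < n | (i != j) && (i != j')) 1.
Hypothesis others_gt0 : 0 < others.

Local Notation L := ('X + others%:P : {poly R}).
Local Notation S := ('X + L%:P : {poly {poly R}}).

(** The outer variable is x, the inner one y. Setting the other variables to 1 hides the degree, so
    [k] records it. *)
Definition part k : {poly {poly R}} :=
  \sum_(a : expv n d | mdeg a == k) (c a *: 'X^(a j')) *: 'X^(a j).

Fixpoint quot k : {poly {poly R}} :=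
  if k is l.+1 then S * quot l - part l.+1 else 1 - part 0.

Lemma coef_part k i e : (part k)`_i`_e =
  \sum_(a : expv n d | mdeg a == k) c a * ((i == a j) && (e == a j'))%:R.
Proof.
rewrite /part !coef_sum; apply: eq_bigr => a _.
rewrite coefZ coefXn; case: (i == a j) => /=; first by rewrite mulr1 coefZ coefXn.
by rewrite !mulr0 coef0.
Qed.

Lemma coef_part_neq0 k i e : (part k)`_i`_e != 0 ->
  exists a : expv n d, [/\ c a != 0, mdeg a = k, a j = i :> nat & a j' = e :> nat].
Proof.
rewrite coef_part => H.
case: (boolP [exists a : expv n d, [&& c a != 0, mdeg a == k, i == a j & e == a j']]).
  by move=> /existsP[a /and4P[ca /eqP ak /eqP ai /eqP ae]]; exists a.
rewrite negb_exists => /forallP none; move: H; rewrite big1 ?eqxx // => a ak.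
have := none a; rewrite ak /=; case: (eqVneq (c a) 0) => [->|_] /=.
  by rewrite mul0r.
by move=> /negbTE->; rewrite mulr0.
Qed.

Lemma part_nneg k : nneg2 (part k).
Proof.
have [c0 _ _ _] := cH.
move=> i e; rewrite coef_part.
by apply: sumr_ge0 => a _; rewrite mulr_ge0.
Qed.

Lemma part_top_neq0 : part d != 0.
Proof.
have [c0 _ [a [ad ca]] _] := cH.
apply/negP => /eqP p0; move: (coef_part d (a j) (a j')); rewrite p0 !coef0 => /esym/eqP.
rewrite psumr_eq0; last by move=> b _; rewrite mulr_ge0.
move=> /allP/(_ a); rewrite mem_index_enum ad !eqxx mulr1 (negbTE ca) /=.
by move=> /(_ isT).
Qed.

Lemma size_part k : (size (part k) <= k.+1)%N.
Proof.
apply/leq_sizeP => i ki; apply/polyP => e; rewrite coef0; apply/eqP/negPn/negP.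
move=> /coef_part_neq0[a [_ ak ai _]]; move: ki; rewrite -ai -ak /mdeg (bigD1 j) //=.
by rewrite -ltnS ltnS ltnNge leq_addr.
Qed.

Lemma size_quot k : (size (quot k) <= k.+1)%N.
Proof.
elim: k => [|k IH] /=.
  by rewrite (leq_trans (size_polyD _ _)) // size_polyN size_poly1 geq_max size_part.
rewrite (leq_trans (size_polyD _ _)) // size_polyN geq_max size_part andbT.
by rewrite (leq_trans (size_polyMleq _ _)) // size_XaddC.
Qed.

Lemma quotE k : quot k = S ^+ k - \sum_(l < k.+1) S ^+ (k - l) * part l.
Proof.
elim: k => [|k IH] /=; first by rewrite big_ord1 !expr0 mul1r.
rewrite IH [in RHS]big_ord_recr /= subnn expr0 mul1r opprD addrA mulrBr -exprS.
congr (_ - _ - _); rewrite mulr_sumr; apply: eq_bigr => l _.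
by rewrite mulrA -exprS subSn // -ltnS.
Qed.

Definition point (x y : R) (i : 'I_n) : R :=
  if i == j then x else if i == j' then y else 1.

Lemma svar_point x y : svar (point x y) = x + (y + others).
Proof.
rewrite /svar (bigD1 j) //= (bigD1 j') //= /point eqxx (negbTE jj') eqxx; do 2 congr (_ + _).
by apply: eq_bigr => i /andP[/negbTE-> /negbTE->].
Qed.

Lemma prod_point x y (a : expv n d) :
  \prod_i point x y i ^+ a i = x ^+ a j * y ^+ a j'.
Proof.
rewrite (bigD1 j) //= (bigD1 j') //= /point eqxx (negbTE jj') eqxx big1 ?mulr1 //.
by move=> i /andP[/negbTE-> /negbTE->]; rewrite expr1n.
Qed.

(** Dividing the point (x, y, 1, ..., 1) by its coordinate sum s puts it on the hyperplane, where p
    is 1; then multiply by [s ^+ d]. *)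
Lemma homogenized x y : 0 < x -> 0 < y ->
  (x + (y + others)) ^+ d =
  \sum_(a : expv n d) c a * (x ^+ a j * y ^+ a j') * (x + (y + others)) ^+ (d - mdeg a).
Proof.
move=> x0 y0; have [_ cd _ Hs] := cH; set s := x + _.
have s0 : s != 0 by rewrite /s gt_eqF // addr_gt0 // addr_gt0.
have /Hs : svar (fun i => point x y i / s) = 1.
  by rewrite /svar -mulr_suml -/(svar (point x y)) svar_point divff.
rewrite /meval => E; rewrite -[LHS]mulr1 -E mulr_sumr; apply: eq_bigr => a _.
case: (leqP (mdeg a) d) => [ad|/cd->]; last by rewrite !mul0r mulr0.
under eq_bigr do rewrite exprMn.
rewrite big_split /= prod_point prodrXr -/(mdeg a) exprVn.
have -> : s ^+ d = s ^+ (d - mdeg a) * s ^+ mdeg a by rewrite -exprD subnK.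
have : s ^+ mdeg a != 0 by rewrite expf_neq0.
move: (s ^+ mdeg a) (s ^+ (d - mdeg a)) => u v u0; field.
exact: u0.
Qed.

(** By [quotE], [quot d] is the difference of the two sides of [homogenized]. It vanishes at all
    pairs of positive integers, hence identically. *)
Lemma quot_top : quot d = 0.
Proof.
have pos_inj : injective (fun k : nat => k.+1%:R : R).
  by move=> k l /eqP; rewrite eqr_nat eqSS => /eqP.
apply: (@poly_nat_roots _ (fun k => (k.+1%:R : R)%:P)) => [k l /polyC_inj/pos_inj //|k].
apply: (@poly_nat_roots _ (fun l => (l.+1%:R : R))) => // l.
have := @homogenized k.+1%:R l.+1%:R (ltr0Sn _ _) (ltr0Sn _ _).
move: (k.+1%:R : R) (l.+1%:R : R) => x y E.
have Se : forall e, (S ^+ e).[x%:P].[y] = (x + (y + others)) ^+ e.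
  by move=> e; rewrite !(horner_exp, hornerE).
have pe l' : (part l').[x%:P].[y] =
    \sum_(a : expv n d | mdeg a == l') c a * (x ^+ a j * y ^+ a j').
  rewrite /part !horner_sum; apply: eq_bigr => a _.
  by rewrite mulrA mulrAC !(hornerE, horner_exp).
have [_ cd _ _] := cH.
rewrite quotE hornerD hornerN hornerD hornerN Se E !horner_sum.
under [X in _ - X]eq_bigr do rewrite !hornerM Se pe mulr_sumr.
apply/eqP; rewrite subr_eq0; apply/eqP.
rewrite (exchange_big_dep xpredT) //=; apply: eq_bigr => a _.
case: (ltnP (mdeg a) d.+1) => [ad|/cd->]; last first.
  by rewrite !mul0r big1 // => i _; rewrite mulr0.
rewrite (big_pred1 (Ordinal ad)) => [|i]; first by rewrite mulrC.
by rewrite /= eq_sym.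
Qed.

Lemma S_neq0 : S != 0. Proof. by rewrite monic_neq0 ?monicXaddC. Qed.

Lemma S_nneg : nneg2 S.
Proof.
move=> i e; rewrite coefD coefX coefC coefD.
apply: addr_ge0; first by case: (i == 1)%N; rewrite ?coef1 ?coef0 ?ler0n.
case: ifP; rewrite ?coef0 // coefD coefX coefC addr_ge0 //.
by case: ifP => // _; apply: ltW.
Qed.

(** Descending from [quot d = 0] by [S * quot k = quot k.+1 + part k.+1], the product is a sum of
    terms [S ^+ (d - l) * part l] with [l > k]. *)
Lemma quot_nneg k : (k <= d)%N -> nneg2 (S ^+ (d - k) * quot k).
Proof.
move=> kd; rewrite -[in quot k](subKn kd); move: (d - k)%N (leq_subr k d) => l.
elim: l => [|l IH] ld; first by rewrite subn0 quot_top mulr0 => i e; rewrite !coef0.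
have -> : S ^+ l.+1 * quot (d - l.+1)%N = S ^+ l * quot (d - l)%N + S ^+ l * part (d - l)%N.
  by rewrite -(subnSK ld) exprSr -mulrA -mulrDr /= subrK.
apply: nneg2D; first by apply: IH; exact: ltnW.
by apply: nneg2M; [apply/nneg2X/S_nneg | apply: part_nneg].
Qed.

Lemma quot_neq0 k : (k < d)%N -> quot k != 0.
Proof.
(* If [quot l = 0], then [quot l.+1] and [part l.+1] add up to 0; times a power of [S] both are
   nonnegative, so both vanish. Carried up to [d], this contradicts [part_top_neq0]. *)
have vanish l : (l < d)%N -> quot l = 0 -> quot l.+1 = 0 /\ part l.+1 = 0.
  move=> ld q0; have E : S ^+ (d - l.+1) * quot l.+1 + S ^+ (d - l.+1) * part l.+1 = 0.
    by rewrite -mulrDr /= q0 mulr0 sub0r addNr mulr0.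
  have := nneg2_addr_eq0 (quot_nneg ld) (nneg2M (nneg2X _ S_nneg) (part_nneg _)) E.
  move=> /eqP; rewrite mulf_eq0 expf_eq0 (negbTE S_neq0) andbF /= => /eqP p0.
  by split => //=; rewrite q0 p0 mulr0 subr0.
move=> kd; apply/eqP => q0.
have zero l : (k <= l < d)%N -> quot l = 0.
  elim: l => [|l IH] /andP[]; first by rewrite leqn0 => /eqP <-.
  rewrite leq_eqVlt => /orP[/eqP<- //|kl] ld.
  have ql : quot l = 0 by apply: IH; lia.
  by have [] := vanish l (ltnW ld) ql.
have q1 : quot d.-1 = 0 by apply: zero; lia.
have d1 : (d.-1 < d)%N by lia.
have [_] := vanish _ d1 q1; rewrite prednK ?(leq_ltn_trans _ kd) // => p0.
by move: part_top_neq0; rewrite p0 eqxx.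
Qed.

(** * Counting the monomials divisible by x *)

Definition mult k i : nat :=
  (\sum_(a : expv n d | (c a != 0)%R) ((mdeg a == k) && (a j == i :> nat)))%N.

Lemma mult_gt0 k i (a : expv n d) : c a != 0 -> mdeg a = k -> a j = i :> nat ->
  (0 < mult k i)%N.
Proof. by move=> ca ak ai; rewrite /mult (bigD1 a) //= ak ai !eqxx. Qed.

Lemma mult_gt1 k i (a b : expv n d) : a != b -> c a != 0 -> c b != 0 ->
  mdeg a = k -> mdeg b = k -> a j = i :> nat -> b j = i :> nat -> (1 < mult k i)%N.
Proof.
move=> ab ca cb ak bk ai bi; rewrite /mult (bigD1 a) //= (bigD1 b) /=; last first.
  by rewrite cb eq_sym.
by rewrite ak bk ai bi !eqxx addnA leq_addr.
Qed.

Lemma sum_mult : (\sum_(1 <= k < d.+1) \sum_(1 <= i < d.+2) mult k i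
  <= #|[set a : expv n d | (c a != 0)%R && (0 < a j)]|)%N.
Proof.
rewrite -sum1dep_card big_mkcondr /=; under eq_bigr do rewrite exchange_big.
rewrite exchange_big /=; apply: leq_sum => a ca.
apply: (@leq_trans (\sum_(1 <= k < d.+1) ((mdeg a == k) && (0 < a j)))%N).
  by apply: leq_sum => k _; exact: sum_eq_leq.
under eq_bigr do rewrite andbC.
by apply: leq_trans (sum_eq_leq _ _ _) _; case: (0 < a j)%N; rewrite //= leq_b1.
Qed.

(** Setting x = 0 in [quot_nneg] shows that a power of [L] times this coefficient is nonnegative,
    and powers of [L] preserve both signs. *)
Lemma sg_quot0 k : (k <= d)%N -> (quot k)`_0 != 0 ->
  lead_sg (quot k)`_0 = 1 /\ low_sg (quot k)`_0 = 1.
Proof.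
move=> kd q0; have [<- <-] := sg_expM others_gt0 (d - k) q0.
have E : L ^+ (d - k) * (quot k)`_0 = (S ^+ (d - k) * quot k)`_0.
  by rewrite -!horner_coef0 !(hornerE, horner_exp).
apply: sg_nneg; first by rewrite E; apply: quot_nneg.
by rewrite mulf_neq0 // expf_neq0 // monic_neq0 ?monicXaddC.
Qed.

(** The next coefficient would be the negative of one of [part k.+1], against the positive sign in
    [sg_quot0]. *)
Lemma quot0_eq0 k : (k < d)%N -> (quot k)`_0 = 0 -> (quot k.+1)`_0 = 0.
Proof.
move=> kd q0; apply/eqP/negPn/negP => q1.
have [lead1 _] := sg_quot0 kd q1; move: lead1.
rewrite /= coef_step0 q0 mulr0 sub0r /lead_sg lead_coefN sgrN.
have : 0 <= lead_coef (part k.+1)`_0 by rewrite lead_coefE; apply: part_nneg.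
by case: sgrP; lra.
Qed.

(** By [quot0_eq0] the cost of losing the bottom coefficient is a difference of indicators, so the
    inequality telescopes in [k]. *)
Lemma view_blocks_quot k : (k < d)%N ->
  (view_blocks d.+2 (quot k) + 2 + 2 * ((quot k.+1)`_0 != 0)%R
    <= view_blocks d.+2 (quot k.+1) + 2 * \sum_(1 <= i < d.+2) mult k.+1 i
       + 2 * ((quot k)`_0 != 0)%R)%N.
Proof.
move=> kd.
have := @view_blocks_step R others others_gt0 (quot k) (part k.+1) (quot_neq0 kd)
  (mult k.+1) d.+2.
move=> H.
have m1 i : (part k.+1)`_i != 0 -> (0 < mult k.+1 i)%N.
  move=> pi; have : lead_coef (part k.+1)`_i != 0 by rewrite lead_coef_eq0.
  by rewrite lead_coefE => /coef_part_neq0[a [ca ak ai _]]; apply: mult_gt0 ca ak ai.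
have m2 i e e' : e != e' -> (part k.+1)`_i`_e != 0 -> (part k.+1)`_i`_e' != 0 ->
    (1 < mult k.+1 i)%N.
  move=> ee /coef_part_neq0[a [ca ak ai ae]] /coef_part_neq0[b [cb bk bi be]].
  apply: (mult_gt1 (a := a) (b := b)) => //.
  by apply: contra ee => /eqP ab; rewrite -ae -be ab.
have bot : (quot k)`_0 != 0 -> (quot k.+1)`_0 != 0 ->
    lead_sg (quot k.+1)`_0 = lead_sg (quot k)`_0 /\ low_sg (quot k.+1)`_0 = low_sg (quot k)`_0.
  by move=> q0 q1; have [-> ->] := sg_quot0 (ltnW kd) q0; apply: sg_quot0.
have sz : (size (quot k) < d.+2)%N by rewrite ltnS (leq_trans (size_quot k)) // ltnS ltnW.
have {m1 m2 bot sz}H := H m1 m2 bot sz; rewrite -/(quot k.+1) in H.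
have mono := @quot0_eq0 k kd.
case: (eqVneq (quot k)`_0 0) mono H => [q0 /(_ q0)->|_ _]; first by rewrite eqxx /=; lia.
by case: (eqVneq (quot k.+1)`_0 0) => _ /=; lia.
Qed.

Lemma card_divisible_ge : (d <= #|[set a : expv n d | (c a != 0)%R && (0 < a j)]|)%N.
Proof.
apply: leq_trans sum_mult.
have main k : (k <= d)%N ->
  (view_blocks d.+2 (quot 0) + 2 * k + 2 * ((quot k)`_0 != 0)%R
   <= view_blocks d.+2 (quot k) + 2 * \sum_(1 <= l < k.+1) \sum_(1 <= i < d.+2) mult l i
      + 2 * ((quot 0)`_0 != 0)%R)%N.
  elim: k => [|k IH] kd; first by rewrite big_geq // muln0 addn0.
  have := view_blocks_quot kd; have {IH} := IH (ltnW kd).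
  have -> : (\sum_(1 <= l < k.+2) \sum_(1 <= i < d.+2) mult l i =
      \sum_(1 <= l < k.+1) \sum_(1 <= i < d.+2) mult l i
      + \sum_(1 <= i < d.+2) mult k.+1 i)%N by exact: big_nat_recr.
  lia.
have blocks0 (s : nat -> R) : s =1 (fun=> 0) -> blocks s d.+2 = 0%N.
  by move=> s0; rewrite /blocks big1 // => i _; rewrite /block_start s0 eqxx.
have {}main := main d (leqnn d).
have first (s : nat -> R) : s 0%N != 0 -> (0 < blocks s d.+2)%N.
  by move=> s0; rewrite /blocks big_ord_recl /block_start /= s0.
(* A nonzero bottom entry starts a block in each view; these two blocks cancel the remaining
   indicator term. *)
have start : (2 * ((quot 0)`_0 != 0)%R <= view_blocks d.+2 (quot 0))%N.
  case: (eqVneq (quot 0)`_0 0) => [//|q0]; rewrite /view_blocks.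
  have /first : view (@lead_coef R) (quot 0) 0 != 0 by rewrite /view sgr_eq0 lead_coef_eq0.
  have /first : view (@low_coef R) (quot 0) 0 != 0 by rewrite /view sgr_eq0 low_coef_eq0.
  by move=> low_gt0 lead_gt0; exact: leq_add lead_gt0 low_gt0.
have end0 : view_blocks d.+2 (quot d) = 0%N.
  rewrite quot_top /view_blocks !blocks0 // => i; rewrite /view coef0.
    by apply/eqP; rewrite sgr_eq0 low_coef_eq0.
  by rewrite lead_coef0 sgr0.
move: main start; rewrite end0 quot_top coef0 eqxx.
lia.
Qed.
End Hyperplane.

Unset Implicit Arguments. Set Strict Implicit.

Theorem mainTheorem18 (R : realFieldType) (n d : nat) (c : expv n d -> R) :
  (3 <= n)%N -> inH c ->
  forall j : 'I_n,
    leq d #|[set a : expv n d | (c a != 0) && (0 < a j)%N]|.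
Proof.
move=> n3 cH j.
have avoid (s : seq 'I_n) : (size s < n)%N -> exists i, i \notin s.
  move=> sn; have /card_gt0P[i] : (0 < #|[predC s]|)%N.
    rewrite -(ltn_add2l #|s|) addn0 cardC card_ord.
    exact: leq_ltn_trans (card_size s) sn.
  by exists i.
have [j'] := avoid [:: j] (ltn_trans (isT : 1 < 2)%N n3); rewrite inE => jj'.
(* A third variable makes [others] positive. *)
have [l] := avoid [:: j; j'] n3; rewrite !inE negb_or => jl.
apply: (card_divisible_ge cH jj'); rewrite /others (bigD1 l) //=.
by rewrite ltr_wpDr // sumr_ge0.
Qed.
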